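(* Suppose we have a derivation in Extended Polynomial Calculus over $\mathbb{Z}$ with the square root rule of an unsatisfiable CNF from $M + x_1 + \ldots + 2^{n - 1}x_n=0$ and the Boolean axioms. Then at least one of the following three conditions holds: \begin{itemize} \item The number of clauses in this CNF is at least $2^{n/3}$. \item We have derived a polynomial equation $C' \cdot (y_j^2 - y_j) = 0$ and the constant $C'$ is divisible by at least $\Omega(2^{n/3})$ different prime numbers. \item There is a clause $C \cdot y_{j_1} \cdots y_{j_k} \cdot \neg{y}_{\ell_1} \cdots \neg{y}_{\ell_r}$ such that the constant $C$ is divisible by at least $\Omega(2^{n/3})$ different prime numbers. \end{itemize}
   Context: $M>0$ is an integer, and the Boolean axioms are $x_i^2-x_i=0$. Extended Polynomial Calculus over $\mathbb{Z}$ derives polynomials (read as equations $=0$) by integer linear combinations and multiplication by variables, allows extension axioms $y_j - q_j(\bar x, y_1,\ldots,y_{j-1})$ introducing new variables, and the square root rule derives $r$ from $r^2$. Deriving an unsatisfiable CNF over $\mathbb{Z}$ means deriving equations $C_i\cdot y_{j_1}\cdots y_{j_k}\cdot\neg y_{\ell_1}\cdots\neg y_{\ell_r}=0$, one per clause, with nonzero integer constants $C_i$, where the $y$'s may be extension variables and $\neg y_\ell$ is an extension variable defined by $\neg y_\ell = 1-y_\ell$, and also deriving $C'_j\cdot(y_j^2-y_j)=0$ with a nonzero integer $C'_j$ for every variable $y_j$ occurring in the CNF. *)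

(* Defs.v *)
(* MathComp world. *)
From mathcomp Require Import all_boot all_order all_algebra.
From mathcomp.multinomials Require Import mpoly.

Set Implicit Arguments.
Unset Strict Implicit.
Unset Printing Implicit Defensive.

Import GRing.Theory.
Local Open Scope ring_scope.

(* Integer polynomials in the variables x_1, ..., x_n (indices [lshift k i]) and
   the extension variables y_1, ..., y_k (indices [rshift n j]). *)
Definition epoly (n k : nat) := {mpoly int[n + k]}.

Section Calculus.
Variables n k : nat.
Implicit Types (p r : epoly n k) (q : 'I_k -> epoly n k) (M : int).

Definition xvar (i : 'I_n) : epoly n k := 'X_(lshift k i).
Definition yvar (j : 'I_k) : epoly n k := 'X_(rshift n j).

(* q_j mentions only x_1, ..., x_n and the extension variables before y_j. *)
Definition extension_wf q : Prop :=
  forall (j : 'I_k) (mon : 'X_{1..n + k}) (v : 'I_(n + k)),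
    mon \in msupp (q j) -> (n + j <= v)%N -> mon v = 0%N.

(* With i ranging over 0, ..., n-1, x_{i+1} has weight 2^i. *)
Definition bvp_poly M : epoly n k :=
  M%:MP + \sum_(i < n) (2 ^+ i)%:MP * xvar i.

Inductive is_axiom M q : epoly n k -> Prop :=
| ax_bvp : is_axiom M q (bvp_poly M)
| ax_bool (i : 'I_n) : is_axiom M q (xvar i ^+ 2 - xvar i)
| ax_ext (j : 'I_k) : is_axiom M q (yvar j - q j).

Inductive rule (prev : seq (epoly n k)) : epoly n k -> Prop :=
| rule_lincomb (a b : int) p r :
    p \in prev -> r \in prev -> rule prev (a *: p + b *: r)
| rule_mulvar (v : 'I_(n + k)) p : p \in prev -> rule prev ('X_v * p)
| rule_sqrt r : r ^+ 2 \in prev -> rule prev r.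

Inductive derivation M q : seq (epoly n k) -> Prop :=
| deriv_nil : derivation M q [::]
| deriv_axiom prev p :
    derivation M q prev -> is_axiom M q p -> derivation M q (rcons prev p)
| deriv_rule prev p :
    derivation M q prev -> rule prev p -> derivation M q (rcons prev p).

End Calculus.

(* The factors of y_{j_1} ... y_{j_k} * ~y_{l_1} ... ~y_{l_r}.  The equation
   "product = 0" says that some factor is false, so that it encodes the clause
   ~y_{j_1} \/ ... \/ ~y_{j_k} \/ y_{l_1} \/ ... \/ y_{l_r}. *)
Record clause (V : Type) := Clause { plain_factors : seq V; neg_factors : seq V }.

Definition clause_sat (V : Type) (a : V -> bool) (c : clause V) : bool :=
  has (fun v => ~~ a v) (plain_factors c) || has a (neg_factors c).

Definition cnf_unsat (V : Type) (m : nat) (F : 'I_m -> clause V) : Prop :=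
  ~ exists a : V -> bool, forall i : 'I_m, clause_sat a (F i).

Definition occurs (V : eqType) (m : nat) (F : 'I_m -> clause V) (v : V) : Prop :=
  exists i : 'I_m, v \in plain_factors (F i) ++ neg_factors (F i).

Section DeriveCNF.
Variables n k : nat.

(* [neg v] is the variable that plays the role of ~v; [neg_def] below forces it to
   be an extension variable whenever ~v is a factor of some clause.  (A codomain
   ['I_k] would rule out derivations without extension variables.) *)
Definition clause_poly (neg : 'I_(n + k) -> 'I_(n + k)) (c : clause 'I_(n + k)) :
    epoly n k :=
  \prod_(v <- plain_factors c) 'X_v * \prod_(v <- neg_factors c) 'X_(neg v).

(* The derivation [pi] derives the CNF [F], the constants being [C i] for the
   i-th clause and [C' v] for the variable v. *)
Record derives_cnf (q : 'I_k -> epoly n k) (pi : seq (epoly n k)) (m : nat)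
    (F : 'I_m -> clause 'I_(n + k)) (neg : 'I_(n + k) -> 'I_(n + k))
    (C : 'I_m -> int) (C' : 'I_(n + k) -> int) : Prop := DerivesCNF {
  neg_def : forall (i : 'I_m) (v : 'I_(n + k)),
    v \in neg_factors (F i) ->
    exists2 j : 'I_k, neg v = rshift n j & q j = 1 - 'X_v;
  clause_const_neq0 : forall i : 'I_m, C i != 0;
  clause_derived : forall i : 'I_m, C i *: clause_poly neg (F i) \in pi;
  bool_const_neq0 : forall v : 'I_(n + k), occurs F v -> C' v != 0;
  bool_derived : forall v : 'I_(n + k),
    occurs F v -> C' v *: ('X_v ^+ 2 - 'X_v : epoly n k) \in pi
}.

End DeriveCNF.

Definition num_prime_divisors (c : int) : nat := size (primes `|c|%N).

(* Main.v *)
Require Import Defs.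
From mathcomp Require Import all_boot all_order all_algebra.
From mathcomp.multinomials Require Import mpoly.
From mathcomp Require Import lra zify.
From mathcomp Require Import reals exp.

(* Let p be a prime with p <= 2^n.  Some number in [0, 2^n) is congruent to -M
   modulo p, and its binary digits, together with the values that the extension
   axioms then force on y_1, ..., y_k, satisfy every axiom in F_p; since F_p is a
   field, the square root rule preserves this, so every derived equation holds
   modulo p.  If p divided no clause constant, each clause would have a vanishing
   factor in F_p, and "v is true iff v has value 1" would satisfy the CNF.  So the
   clause constants together have at least as many prime divisors as there are
   primes up to 2^n, and this number is at least 2^n / (2n) by Chebyshev's argument
   on the binomial coefficient 'C(2^n, 2^(n-1)).  With fewer than 2^(n/3) clauses,
   one constant has at least 2^(n/3) / 4 of them, because n <= 2 * 2^(n/3). *)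

Set Implicit Arguments.
Unset Strict Implicit.
Unset Printing Implicit Defensive.

Import Order.TTheory GRing.Theory Num.Theory.
Local Open Scope ring_scope.

(** * Prime divisors of binomial coefficients *)

Lemma logn_bin_le_trunc_log p N k : prime p -> (k <= N)%N ->
  (logn p 'C(N, k) <= trunc_log p N)%N.
Proof.
move=> p_pr le_kN; have p_gt1 := prime_gt1 p_pr.
(* Legendre's formula, with zero terms added up to the common bound [N] so that the three factorials
   can be compared term by term. *)
have sum_floors K : (K <= N)%N ->
    (logn p K`! = \sum_(1 <= e < N.+1) K %/ p ^ e)%N.
  move=> le_KN; rewrite logn_fact // [RHS](@big_cat_nat _ _ _ K.+1) //= ?ltnS //.
  rewrite [X in (_ = _ + X)%N]big1_seq ?addn0 // => e.
  rewrite mem_index_iota => /andP[_ /andP[lt_Ke _]].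
  by rewrite divn_small // (leq_trans lt_Ke) // ltnW // ltn_expl.
have := congr1 (logn p) (bin_fact le_kN).
rewrite !lognM ?muln_gt0 ?fact_gt0 ?bin_gt0 // !sum_floors ?leq_subr //.
move=> defS.
suff: (\sum_(1 <= e < N.+1) N %/ p ^ e <=
    trunc_log p N + (\sum_(1 <= e < N.+1) k %/ p ^ e +
                     \sum_(1 <= e < N.+1) (N - k) %/ p ^ e))%N
  by rewrite -defS leq_add2r.
(* Kummer: each power of p up to N contributes at most one carry. *)
have le1 e : (N %/ p ^ e <=
    (e <= trunc_log p N) + (k %/ p ^ e + (N - k) %/ p ^ e))%N.
  case: (leqP e) => [_|lt_e].
    rewrite -{1}(subnKC le_kN) divnD ?expn_gt0 ?prime_gt0 //.
    by rewrite addnC leq_add2r leq_b1.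
  rewrite divn_small // ltnNge; apply/negP => /(trunc_log_max p_gt1).
  by rewrite leqNgt lt_e.
apply: leq_trans (leq_sum _ (fun e _ => le1 e)) _.
rewrite !big_split /= leq_add2r.
have [N0|N_gt0] := posnP N; first by rewrite big_geq ?N0.
have le_lN : (trunc_log p N <= N)%N.
  exact: leq_trans (ltnW (ltn_expl _ p_gt1)) (trunc_logP p_gt1 N_gt0).
rewrite (@big_cat_nat _ _ _ (trunc_log p N).+1) //=.
rewrite [X in (_ + X)%N]big1_seq ?addn0; last first.
  move=> e; rewrite mem_index_iota => /andP[_ /andP[lt_e _]].
  by rewrite leqNgt lt_e.
apply: leq_trans (leq_sum _ (fun e _ => leq_b1 _)) _.
by rewrite sum_nat_const_nat muln1 subn1.
Qed.

(** Each prime power in the factorization of the binomial coefficient is at most [N], and there is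
    one for each prime divisor. *)
Lemma bin_le_expn_primes N k : (k <= N)%N ->
  ('C(N, k) <= N ^ size (primes 'C(N, k)))%N.
Proof.
move=> le_kN; have [N0|N_gt0] := posnP N.
  by move: le_kN; rewrite N0 leqn0 => /eqP->.
have C_gt0 : (0 < 'C(N, k))%N by rewrite bin_gt0.
rewrite {1}(prod_prime_decomp C_gt0) prime_decompE big_map /=.
rewrite -[leqRHS]iter_muln_1 -count_predT -big_const_seq big_seq [leqRHS]big_seq.
apply: leq_prod => p.
rewrite mem_primes => /andP[p_pr _].
apply: leq_trans (trunc_logP (prime_gt1 p_pr) N_gt0).
by rewrite leq_exp2l ?prime_gt1 // logn_bin_le_trunc_log.
Qed.

Lemma prime_dvd_bin_le p N k : p \in primes 'C(N, k) -> (p <= N)%N.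
Proof.
rewrite mem_primes => /and3P[p_pr C_gt0 p_dvd].
have le_kN : (k <= N)%N by rewrite -bin_gt0.
have N_gt0 : (0 < N)%N.
  case: N C_gt0 le_kN p_dvd => //; rewrite leqn0 => _ /eqP->.
  by rewrite bin0 Euclid_dvd1.
apply: leq_trans (trunc_logP (prime_gt1 p_pr) N_gt0).
rewrite -[leqLHS]expn1 leq_exp2l ?prime_gt1 //.
apply: leq_trans (logn_bin_le_trunc_log p_pr le_kN).
by rewrite logn_gt0 mem_primes p_pr C_gt0.
Qed.

(** Two uses of Pascal's rule show that each step from [k] to [k + 1] at least doubles the central
    coefficient. *)
Lemma expn2_le_central_bin k : (2 ^ k <= 'C(k.*2, k))%N.
Proof.
elim: k => // k IHk; rewrite doubleS binS expnS mul2n -addnn.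
rewrite leq_add //; first by rewrite binS (leq_trans IHk) ?leq_addl.
by case: k IHk => // k IHk; rewrite binS (leq_trans IHk) ?leq_addr.
Qed.

(** The coefficient lies between [2 ^ 2 ^ n.-1] and [(2 ^ n) ^ s], where [s] is its number of prime
    divisors; comparing exponents of 2 gives the bound. *)
Lemma expn2_le_size_primes_bin n : (0 < n)%N ->
  (2 ^ n <= 2 * (n * size (primes 'C(2 ^ n, 2 ^ n.-1))))%N.
Proof.
case: n => // n _; rewrite {1}expnS leq_pmul2l //= -(leq_exp2l (m := 2)) // expnM.
apply: leq_trans (bin_le_expn_primes _); last by rewrite leq_exp2l.
by rewrite expnS mul2n expn2_le_central_bin.
Qed.

Lemma cube_le_expn2 n : (n ^ 3 <= 8 * 2 ^ n)%N.
Proof.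
have [|ge4] := ltnP n 4; first by case: n => [|[|[|[|]]]].
elim: n ge4 => // n IHn; rewrite leq_eqVlt => /predU1P[<- //|lt4n].
apply: (@leq_trans (2 * n ^ 3)); last first.
  by rewrite [(2 ^ n.+1)%N]expnS mulnCA leq_mul2l IHn.
(* For [n >= 4], [3n^2 + 3n + 1 <= 4n^2 <= n^3], hence [(n + 1)^3 <= 2n^3]. *)
have : (4 * (n * n) <= n * (n * n))%N by rewrite leq_mul2r -ltnS lt4n orbT.
by rewrite !expnS !expn0 !muln1; nia.
Qed.

Lemma primes_cover (I : finType) (s : seq nat) (c : I -> nat) : uniq s ->
  {in s, forall p, exists i, p \in primes (c i)} ->
  (size s <= \sum_i size (primes (c i)))%N.
Proof.
move=> s_uniq s_cov.
have -> : (\sum_i size (primes (c i)) =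
    size (flatten [seq primes (c i) | i <- index_enum I]))%N.
  by rewrite size_flatten sumnE !big_map.
apply: uniq_leq_size => // p /s_cov[i p_i].
by apply/flatten_mapP; exists i; rewrite ?mem_index_enum.
Qed.

(** * Evaluating derivations at points *)

Local Notation evalp v := (mmap intr v).

Lemma eq_mmap_msupp (K : comNzRingType) (l : nat) (v w : 'I_l -> K)
    (p : {mpoly int[l]}) :
  (forall i, v i = w i \/ {in msupp p, forall mon : 'X_{1..l}, mon i = 0%N}) ->
  evalp v p = evalp w p.
Proof.
move=> eq_vw; rewrite /mmap; apply: eq_big_seq => mon mon_p.
congr (_ * _); apply: eq_bigr => i _.
by case: (eq_vw i) => [->|->].
Qed.

Section Models.
Variables (n k : nat) (M : int) (q : 'I_k -> epoly n k).

Lemma extension_solution (K : comNzRingType) (x : 'I_n -> K) : extension_wf q ->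
  exists v : 'I_(n + k) -> K,
    (forall i, v (lshift k i) = x i) /\ forall j, v (rshift n j) = evalp v (q j).
Proof.
move=> q_wf.
suff /(_ k (leqnn k))[v [vx vq]] : forall t, (t <= k)%N ->
    exists v : 'I_(n + k) -> K, (forall i, v (lshift k i) = x i) /\
      forall j : 'I_k, (j < t)%N -> v (rshift n j) = evalp v (q j).
  by exists v; split=> // j; apply: vq.
elim=> [_|t IHt lt_tk].
  exists (fun i => if split i is inl i then x i else 0); split=> // i.
  by rewrite (unsplitK (inl i)).
have [v [vx vq]] := IHt (ltnW lt_tk); pose s := Ordinal lt_tk.
(* Only the value of extension variable number [t] changes. No [q j] with [j <= t] mentions it, so
   the earlier equations survive. *)
pose w i := if i == rshift n s then evalp v (q s) else v i.
have eq_wv (j : 'I_k) : (j <= t)%N -> evalp w (q j) = evalp v (q j).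
  move=> le_jt; apply: eq_mmap_msupp => i; rewrite /w.
  case: eqP => [->|_]; last by left.
  by right=> mon mon_qj; apply: q_wf mon_qj _; rewrite leq_add2l.
exists w; split=> [i|j]; first by rewrite /w eq_lrshift.
rewrite ltnS => le_jt; rewrite eq_wv // /w eq_rshift; case: eqP => [->//|ne_js].
by rewrite vq // ltn_neqAle le_jt andbT; apply/eqP => eq_jt; apply/ne_js/val_inj.
Qed.

Lemma derivation_sound (K : idomainType) (v : 'I_(n + k) -> K) pi :
  (forall p, is_axiom M q p -> evalp v p = 0) ->
  derivation M q pi -> {in pi, forall p, evalp v p = 0}.
Proof.
move=> v_ax; elim=> [|{}pi p _ IHpi p_ax|{}pi p _ IHpi p_rule] r;
  rewrite ?mem_rcons ?inE // => /predU1P[->|/IHpi //]; first exact: v_ax.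
case: p_rule => [a b p1 p2 /IHpi p1_0 /IHpi p2_0|i p1 /IHpi p1_0|p1 /IHpi].
- by rewrite rmorphD /= !mmapZ p1_0 p2_0 !mulr0 addr0.
- by rewrite rmorphM /= p1_0 mulr0.
- by rewrite rmorphXn /= => /eqP; rewrite sqrf_eq0 => /eqP.
Qed.

End Models.

(** * Boolean solutions modulo a prime *)

Lemma binary_expansion (n r : nat) : (r < 2 ^ n)%N ->
  (\sum_(i < n) 2 ^ i * odd (r %/ 2 ^ i) = r)%N.
Proof.
elim: n r => [|d IHd] r; first by rewrite big_ord0 expn0 ltnS leqn0 => /eqP.
rewrite expnS => lt_r; rewrite big_ord_recl expn0 divn1 mul1n -[RHS]odd_double_half.
congr (_ + _)%N; rewrite -[X in _ = X.*2]IHd; last first.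
  by rewrite ltn_half_double -mul2n.
rewrite -muln2 big_distrl; apply: eq_bigr => i _ /=.
by rewrite expnS divnMA divn2 -mulnA mulnC.
Qed.

Lemma boolean_solution (n p : nat) (M : int) : prime p -> (p <= 2 ^ n)%N ->
  exists b : 'I_n -> bool, M%:~R + \sum_(i < n) 2 ^+ i * (b i)%:R = 0 :> 'F_p.
Proof.
(* [r] also serves as a natural number, its representative below [p], which therefore has at most
   [n] binary digits. *)
move=> p_pr le_p; pose r : 'F_p := - M%:~R.
have lt_r : (r < 2 ^ n)%N.
  by apply: leq_trans (ltn_ord r) _; rewrite Fp_cast.
exists (fun i => odd (r %/ 2 ^ i)).
rewrite [X in _ + X](_ : _ = r) ?subrr //.
rewrite -[RHS]natr_Zp -{2}(binary_expansion lt_r) natr_sum.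
by apply: eq_bigr => i _; rewrite natrM natrX.
Qed.

Lemma prime_divides_clause_const (n k p : nat) (M : int) (q : 'I_k -> epoly n k)
    (pi : seq (epoly n k)) (m : nat) (F : 'I_m -> clause 'I_(n + k))
    (neg : 'I_(n + k) -> 'I_(n + k)) (C : 'I_m -> int) (C' : 'I_(n + k) -> int) :
  extension_wf q -> derivation M q pi -> cnf_unsat F ->
  derives_cnf q pi F neg C C' -> prime p -> (p <= 2 ^ n)%N ->
  exists i, p \in primes `|C i|.
Proof.
move=> q_wf pi_der F_unsat [neg_def C_neq0 C_der _ _] p_pr le_p.
have [b b_sol] := boolean_solution M p_pr le_p.
have [v [vx vq]] := extension_solution (fun i => (b i)%:R : 'F_p) q_wf.
have v_ax r : is_axiom M q r -> evalp v r = 0.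
  case=> [|i|j]; last by rewrite rmorphB /= mmapX mmap1U vq subrr.
    rewrite rmorphD rmorph_sum /= mmapC -[RHS]b_sol; congr (_ + _).
    apply: eq_bigr => i _.
    by rewrite rmorphM /= mmapC mmapX mmap1U vx /= rmorphXn.
  rewrite rmorphB rmorphXn /= mmapX mmap1U vx.
  by case: (b i); rewrite ?expr1n ?expr0n ?subrr.
have v_pi := derivation_sound v_ax pi_der.
have [/existsP[i p_i] | /existsPn p_C] := boolP [exists i, p \in primes `|C i|].
  by exists i.
(* A plain factor vanishes only at 0 and a negated one only at 1, so values other
   than 0 and 1 may be read as false. *)
case: F_unsat; exists (fun u => v u == 1) => i.
have Ci_neq0 : (C i)%:~R != 0 :> 'F_p.
  apply: contra (p_C i); rewrite -(dvdz_pcharf (pchar_Fp p_pr)) dvdzE absz_nat.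
  by rewrite mem_primes p_pr absz_gt0 C_neq0.
have /eqP := v_pi _ (C_der i).
rewrite mmapZ mulf_eq0 (negPf Ci_neq0) /= /clause_poly rmorphM /= !rmorph_prod.
rewrite mulf_eq0 !prodf_seq_eq0 => /orP[]/hasP[u u_i] /= /eqP;
  rewrite mmapX mmap1U => vu0; apply/orP.
  by left; apply/hasP; exists u; rewrite // vu0 eq_sym oner_eq0.
have [j neg_u q_j] := neg_def _ _ u_i.
right; apply/hasP; exists u => //.
move: vu0; rewrite neg_u vq q_j rmorphB rmorph1 /= mmapX mmap1U => /eqP.
by rewrite subr_eq0 eq_sym.
Qed.

Theorem theorem4 (R : realType) :
  exists c : R, 0 < c /\
  forall (n : nat) (M : int), 0 < M ->
  forall (k : nat) (q : 'I_k -> epoly n k) (pi : seq (epoly n k))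
    (m : nat) (F : 'I_m -> clause 'I_(n + k)) (neg : 'I_(n + k) -> 'I_(n + k))
    (C : 'I_m -> int) (C' : 'I_(n + k) -> int),
  extension_wf q ->
  derivation M q pi ->
  cnf_unsat F ->
  derives_cnf q pi F neg C C' ->
  [\/ (2 : R) `^ (n%:R / 3) <= m%:R,
      exists v : 'I_(n + k), occurs F v /\
        c * (2 : R) `^ (n%:R / 3) <= (num_prime_divisors (C' v))%:R
    | exists i : 'I_m,
        c * (2 : R) `^ (n%:R / 3) <= (num_prime_divisors (C i))%:R].
Proof.
exists 4^-1; split=> [|n M _ k q pi m F neg C C' q_wf pi_der F_unsat F_der].
  by rewrite invr_gt0.
set t := 2 `^ _; have t_gt0 : 0 < t by rewrite powR_gt0.
have t3 : t ^+ 3 = (2 ^ n)%:R.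
  by rewrite -powR_mulrn ?ltW // -powRrM divfK ?pnatr_eq0 // powR_mulrn // natrX.
have [|lt_mt] := leP t m%:R; first by constructor 1.
have [/existsP|/existsPn few_primes] :=
    boolP [exists i, 4^-1 * t <= (num_prime_divisors (C i))%:R].
  by constructor 3.
exfalso.
(* For [n = 0] the assumption [m < t] reads [m < 1], and an empty CNF is satisfiable. *)
have [n0|n_gt0] := posnP n.
  have m0 : m = 0%N.
    move: lt_mt; rewrite /t n0 mul0r powRr0 -[1]/(1%:R) ltr_nat.
    by case: (m).
  by apply: F_unsat; exists xpredT => i; have := ltn_ord i; rewrite {2}m0.
have := expn2_le_size_primes_bin n_gt0.
set P := primes _ => le_P.
have le_sum : (size P <= \sum_(i < m) num_prime_divisors (C i))%N.
  apply: primes_cover => [|p p_P]; first exact: primes_uniq.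
  have le_p := prime_dvd_bin_le p_P.
  apply: prime_divides_clause_const q_wf pi_der F_unsat F_der _ le_p.
  by move: p_P; rewrite mem_primes => /andP[].
have le_sumR : (size P)%:R <= m%:R * (4^-1 * t).
  apply: (@le_trans _ _ (\sum_(i < m) (num_prime_divisors (C i))%:R)).
    by rewrite -natr_sum ler_nat.
  rewrite mulr_natl -[X in _ *+ X]card_ord -sumr_const; apply: ler_sum => i _.
  by rewrite ltW // ltNge few_primes.
have le_nt : n%:R <= 2 * t.
  rewrite -(ler_pXn2r (n := 3)) ?nnegrE ?mulr_ge0 ?(ltW t_gt0) //.
  by rewrite exprMn t3 -!natrX -natrM ler_nat cube_le_expn2.
(* The contradiction is [t^3 <= 2 n |P| <= 2 (2 t) (m t / 4) = m t^2 < t^3]; the constant 1/4 is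
   chosen to cancel the two factors 2. *)
have : t ^+ 3 <= 2 * (n%:R * (size P)%:R) by rewrite t3 -!natrM ler_nat.
apply/negP; rewrite -ltNge.
have : n%:R * (size P)%:R <= 2 * t * (m%:R * (4^-1 * t)) by rewrite ler_pM.
have : m%:R * t ^+ 2 < t * t ^+ 2 by rewrite ltr_pM2r ?exprn_gt0.
nra.
Qed.
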